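(* Let $p$ be a prime, let $X=\mathbb{Z}_p$ be the ring of $p$-adic integers with its usual topology, and let $T:\mathbb{Z}_p\to\mathbb{Z}_p$ be the map defined by a polynomial in $\mathbb{Z}_p[z]$. Let $\ell\ge 1$ be an integer, let $q_1,\dots,q_\ell\in\mathbb{Q}[z]$ be polynomials with $q_j(n)\in\mathbb{N}$ for every integer $n\ge 0$ and every $1\le j\le\ell$, put $\Delta:=\max_{1\le j\le \ell}\deg q_j$, where $\Delta\ge 1$, and let $(c_n)_{n\ge 0}$ be a sequence of complex numbers that is oscillating of order $\Delta$ and satisfies $\sum_{n=1}^{N}|c_n|=O(N)$ as $N\to\infty$. Then for every continuous function $F\in C(X^\ell)$ (complex valued) and every point $x\in X$, $$\lim_{N\to\infty}\frac1N\sum_{n=0}^{N-1}c_n\,F\bigl(T^{q_1(n)}x,\dots,T^{q_\ell(n)}x\bigr)=0 .$$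
   Context: $\mathbb{N}=\{0,1,2,\dots\}$; $T^n$ denotes the $n$-th iterate of $T$ and $T^0$ is the identity. For an integer $d\ge 1$, a sequence of complex numbers $(c_n)_{n\ge 0}$ is oscillating of order $d$ if for every real polynomial $P\in\mathbb{R}[z]$ of degree at most $d$ one has $\lim_{N\to\infty}\frac1N\sum_{n=0}^{N-1}c_n e^{2\pi i P(n)}=0$. *)

(* Defs.v *)
From HB Require Import structures.
From mathcomp Require Import all_boot all_order all_algebra.
From mathcomp Require Import all_classical all_reals all_analysis.
From mathcomp Require Import complex.

Set Implicit Arguments.
Unset Strict Implicit.
Unset Printing Implicit Defensive.

Import Order.TTheory GRing.Theory Num.Theory.
Import numFieldNormedType.Exports.

Local Open Scope classical_set_scope.
Local Open Scope ring_scope.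

(* The ring Z_p as the inverse limit of the rings Z/p^k: a p-adic integer is a
   sequence of residues, [residue x k] being the representative in [0, p^k[ of
   the image of x in Z/p^k. The range condition is part of [residueP], since
   the right-hand side is a reduction modulo p^k. *)
Record padic_int (p : nat) (p_pr : prime p) := PadicInt {
  residue : nat -> int;
  residueP : forall k, residue k = (residue k.+1 %% (p ^ k)%:Z)%Z
}.

Section PadicRing.
Variables (p : nat) (p_pr : prime p).
Local Notation Zp := (padic_int p_pr).
Implicit Types x y z : Zp.

HB.instance Definition _ := gen_eqMixin Zp.
HB.instance Definition _ := gen_choiceMixin Zp.

Lemma padic_eq x y : (forall k, residue x k = residue y k) -> x = y.
Proof.
case: x y => [x xP] [y yP] /= /funext exy; case: y / exy yP => yP.
by congr PadicInt; exact: Prop_irrelevance.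
Qed.

Lemma residue_mod x k : (residue x k %% (p ^ k)%:Z)%Z = residue x k.
Proof. by rewrite residueP modz_mod. Qed.

Lemma reduce_subproof (u : nat -> int) :
  (forall k, (u k = u k.+1 %[mod (p ^ k)%:Z])%Z) ->
  forall k, (u k %% (p ^ k)%:Z)%Z =
            ((u k.+1 %% (p ^ k.+1)%:Z)%Z %% (p ^ k)%:Z)%Z.
Proof.
move=> uP k; rewrite uP; apply/eqP; rewrite eq_sym eqz_mod_dvd.
apply: (@dvdz_trans (p ^ k.+1)%:Z).
  by rewrite expnSr PoszM dvdz_mulr.
by rewrite -eqz_mod_dvd modz_mod.
Qed.

Definition reduce u uP : Zp := PadicInt p_pr (@reduce_subproof u uP).

Lemma residueS x k : (residue x k = residue x k.+1 %[mod (p ^ k)%:Z])%Z.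
Proof. by rewrite -residueP residue_mod. Qed.

Definition padic0 : Zp := @reduce (fun=> 0) (fun=> erefl).
Definition padic1 : Zp := @reduce (fun=> 1) (fun=> erefl).

Lemma padic_opp_subproof x k :
  (- residue x k = - residue x k.+1 %[mod (p ^ k)%:Z])%Z.
Proof. by rewrite -modzNm residueS modzNm. Qed.
Definition padic_opp x : Zp := reduce (padic_opp_subproof x).

Lemma padic_add_subproof x y k :
  (residue x k + residue y k = residue x k.+1 + residue y k.+1
     %[mod (p ^ k)%:Z])%Z.
Proof. by rewrite -modzDm !residueS modzDm. Qed.
Definition padic_add x y : Zp := reduce (padic_add_subproof x y).

Lemma padic_mul_subproof x y k :
  (residue x k * residue y k = residue x k.+1 * residue y k.+1
     %[mod (p ^ k)%:Z])%Z.
Proof. by rewrite -modzMm !residueS modzMm. Qed.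
Definition padic_mul x y : Zp := reduce (padic_mul_subproof x y).

Lemma padic_addA : associative padic_add.
Proof. by move=> x y z; apply: padic_eq => k /=; rewrite modzDml modzDmr addrA. Qed.

Lemma padic_addC : commutative padic_add.
Proof. by move=> x y; apply: padic_eq => k /=; rewrite addrC. Qed.

Lemma padic_add0 : left_id padic0 padic_add.
Proof. by move=> x; apply: padic_eq => k /=; rewrite modzDml add0r residue_mod. Qed.

Lemma padic_addN : left_inverse padic0 padic_opp padic_add.
Proof. by move=> x; apply: padic_eq => k /=; rewrite modzDml addNr. Qed.

HB.instance Definition _ :=
  GRing.isZmodule.Build Zp padic_addA padic_addC padic_add0 padic_addN.

Lemma padic_mulA : associative padic_mul.
Proof. by move=> x y z; apply: padic_eq => k /=; rewrite modzMml modzMmr mulrA. Qed.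

Lemma padic_mulC : commutative padic_mul.
Proof. by move=> x y; apply: padic_eq => k /=; rewrite mulrC. Qed.

Lemma padic_mul1 : left_id padic1 padic_mul.
Proof. by move=> x; apply: padic_eq => k /=; rewrite modzMml mul1r residue_mod. Qed.

Lemma padic_mulDl : left_distributive padic_mul padic_add.
Proof.
by move=> x y z; apply: padic_eq => k /=; rewrite modzMml modzDm mulrDl.
Qed.

Lemma padic_1neq0 : padic1 != padic0.
Proof.
apply/eqP => /(congr1 (fun x => residue x 1)) /=.
by rewrite expn1 mod0z modz_small //= ltz_nat prime_gt1.
Qed.

HB.instance Definition _ := GRing.Zmodule_isComNzRing.Build Zp
  padic_mulA padic_mulC padic_mul1 padic_mulDl padic_1neq0.

(* The p-adic topology, through its uniform structure: the entourages are
   generated by the congruences modulo p^k, so that a basis of neighbourhoods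
   of x is given by the classes x + p^k Z_p. *)
Definition padic_ent : set_system (Zp * Zp) :=
  filter_from [set: nat] (fun k => [set xy | residue xy.1 k = residue xy.2 k]).

Lemma residue_le x y k m : (k <= m)%N ->
  residue x m = residue y m -> residue x k = residue y k.
Proof.
elim: m => [|m IH]; first by rewrite leqn0 => /eqP ->.
rewrite leq_eqVlt => /orP[/eqP -> //|km] e.
by apply: IH => //; rewrite residueP e -residueP.
Qed.

Lemma padic_ent_filter : Filter padic_ent.
Proof.
apply: filter_from_filter; first by exists 0%N.
move=> i j _ _; exists (maxn i j) => // -[x y] /= e.
by split; apply: residue_le e; rewrite ?leq_maxl ?leq_maxr.
Qed.

Local Open Scope relation_scope.

Lemma padic_ent_refl A : padic_ent A -> diagonal `<=` A.
Proof. by move=> [k _ kA] [x y] /= /diagonalP e; apply: kA => /=; rewrite e. Qed.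

Lemma padic_ent_inv A : padic_ent A -> padic_ent A^-1.
Proof. by move=> [k _ kA]; exists k => // -[x y] /= e; apply: kA => /=. Qed.

Lemma padic_ent_split A :
  padic_ent A -> exists2 B, padic_ent B & B \; B `<=` A.
Proof.
move=> [k _ kA]; exists [set xy | residue xy.1 k = residue xy.2 k].
  by exists k.
by move=> [x z] [y /= exy eyz]; apply: kA => /=; rewrite exy.
Qed.

HB.instance Definition _ := isUniform.Build Zp
  padic_ent_filter padic_ent_refl padic_ent_inv padic_ent_split.

End PadicRing.

(* exp(2 pi i t) for real t *)
Definition e2pi (R : realType) (t : R) : R[i] :=
  Complex (cos (2 * pi * t)) (sin (2 * pi * t)).

(* [R[i]^o] is R[i] with its usual topology, given by the modulus. *)
Definition oscillating (R : realType) (d : nat) (c : nat -> R[i]) : Prop :=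
  forall P : {poly R}, (size P <= d.+1)%N ->
    (fun N : nat => N%:R^-1 * \sum_(0 <= n < N) c n * e2pi P.[n%:R] : R[i]^o)
      @ \oo --> (0 : R[i]^o).

(* Main.v *)
Require Import Defs.
From mathcomp Require Import all_boot all_order all_algebra.
From mathcomp Require Import all_classical all_reals all_analysis.
From mathcomp Require Import complex.
From mathcomp Require Import ring lra zify.
Import Order.TTheory GRing.Theory Num.Theory.
Import numFieldNormedType.Exports.
Local Open Scope classical_set_scope.
Local Open Scope ring_scope.

(** The weights [c] average to zero against every eventually periodic sequence,
    and the sequence [n |-> F (T^(q_1 n) x, .., T^(q_l n) x)] is a uniform limit
    of eventually periodic ones.

    Periodicity comes from arithmetic modulo [p^k].  A polynomial map respects
    congruences modulo [p^k], so the residue of [T^n x] is an orbit of a self-map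
    of a finite set, hence eventually periodic in [n], with some period [r]
    ([residue_orbit_eventually_periodic]).  A natural-valued rational polynomial
    [q] is itself periodic modulo [r], because clearing denominators turns it
    into an integer polynomial; and it is either constant or eventually beyond
    the preperiod.  Therefore the residue of [T^(q n) x] is eventually periodic
    in [n] ([eventually_periodic_nat_valued]).

    Uniform approximation comes from compactness.  The space [Z_p^l] being
    compact, [F] changes by at most [eps] between points with the same
    coordinates modulo a suitable [p^k] ([uniformly_continuous_mod]).  Replacing
    [n] by a representative [rho n] of its class under the eventual period of
    these residues gives an eventually periodic sequence at distance at most
    [eps] from the original one.

    As for the averages, a periodic sequence is a combination of the characters
    [n |-> exp(2 pi i a n / M)], to which the oscillation of [c] applies with the
    linear phases [(a / M) X]; a finite number of terms does not matter
    ([orthogonal_eventually_periodic]); and since the means of [|c n|] are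
    bounded, the condition passes to uniform limits
    ([orthogonal_uniform_limit]). *)

(** * Eventually periodic sequences *)

Definition eventually_periodic {A : Type} (g : nat -> A) :=
  exists m M, (0 < M)%N /\ forall n, (m <= n)%N -> g (n + M)%N = g n.

Lemma periodic_mul {A : Type} {g : nat -> A} {m M} k :
  (forall n, (m <= n)%N -> g (n + M)%N = g n) ->
  forall n, (m <= n)%N -> g (n + k * M)%N = g n.
Proof.
move=> gP n mn; elim: k => [|k IH]; first by rewrite mul0n addn0.
by rewrite mulSnr addnA gP ?IH // (leq_trans mn) ?leq_addr.
Qed.

Lemma eventually_periodic_eqmod {A : Type} {g : nat -> A} {m M} :
  (forall n, (m <= n)%N -> g (n + M)%N = g n) ->
  forall a b, (m <= a)%N -> (m <= b)%N -> a = b %[mod M] -> g a = g b.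
Proof.
move=> gP a b ma mb; wlog le_ab : a b ma mb / (a <= b)%N.
  by move=> H; case/orP: (leq_total a b) => ? ?; [|symmetry]; apply: H.
move=> /eqP; rewrite eq_sym eqn_mod_dvd // => /dvdnP[k abk].
by rewrite -(subnKC le_ab) abk (periodic_mul _ gP).
Qed.

(** The largest preperiod and the product of the periods serve all the members
    of the family at once. *)
Lemma eventually_periodic_family {l : nat} {A : Type} (g : 'I_l -> nat -> A) :
  (forall j, eventually_periodic (g j)) ->
  eventually_periodic (fun n j => g j n).
Proof.
move=> /choice[m] /choice[M] gP.
exists (\max_j m j), (\prod_j M j)%N; split.
  by apply: prodn_gt0 => j; have [] := gP j.
move=> n mn; apply/funext => j; have [_ gj] := gP j.
rewrite (bigD1 j) //= mulnC (periodic_mul _ gj) //.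
exact: leq_trans (leq_bigmax j) mn.
Qed.

(** Lets an eventually periodic invariant [g] of the index act on any finer
    sequence [h]: the sequence [h \o rho] is eventually periodic, and it only
    evaluates [h] at indices with the right value of [g].  No section of [g] has
    to be chosen. *)
Lemma eventually_periodic_retract {A : Type} {g : nat -> A} :
  eventually_periodic g ->
  exists2 rho : nat -> nat, eventually_periodic rho & forall n, g (rho n) = g n.
Proof.
move=> [m [M [M_gt0 gP]]].
exists (fun n => if (n < m)%N then n else (m + (n - m) %% M)%N).
  exists m, M; split=> // n mn.
  by rewrite !ltnNge mn (leq_trans mn) ?leq_addr //= -addnBAC // modnDr.
move=> n; case: ltnP => // mn.
apply: (eventually_periodic_eqmod gP) => //; first exact: leq_addr.
by rewrite modnDmr subnKC.
Qed.

Lemma eventually_periodic_comp {A B : Type} (h : A -> B) {g : nat -> A} :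
  eventually_periodic g -> eventually_periodic (h \o g).
Proof.
by move=> [m [M [M_gt0 gP]]]; exists m, M; split=> // n mn /=; rewrite gP.
Qed.

(** Pigeonhole: among the first [N + 1] points of the orbit two have the same
    [rep], and from then on the orbit repeats itself up to [rep]. *)
Lemma eventually_periodic_iter {A : Type} (N : nat) (rep : A -> nat)
    (T : A -> A) (x : A) :
  (forall y, (rep y < N)%N) ->
  (forall y z, rep y = rep z -> rep (T y) = rep (T z)) ->
  eventually_periodic (fun n => rep (iter n T x)).
Proof.
move=> repN repT.
have iterP n y z : rep y = rep z -> rep (iter n T y) = rep (iter n T z).
  by move=> yz; elim: n => //= n; exact: repT.
pose h (i : 'I_N.+1) : 'I_N := Ordinal (repN (iter i T x)).
have /injectivePn[i [j ij hij]] : ~~ injectiveb h.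
  by apply/injectiveP => /leq_card; rewrite !card_ord ltnn.
wlog lt_ij : i j ij hij / (i < j)%N.
  move=> H; case: (ltngtP i j) => [||/val_inj/eqP]; last by rewrite (negPf ij).
  - exact: H.
  - by apply: H; rewrite 1?eq_sym.
exists i, (j - i)%N; split=> [|n le_in]; first by rewrite subn_gt0.
have -> : (n + (j - i) = (n - i) + j)%N by lia.
rewrite -[in RHS](subnK le_in) !iterD; apply: iterP.
by have /(congr1 val) := hij.
Qed.

(** * Polynomial orbits modulo a power of p *)

Lemma horner_residue {p : nat} {p_pr : prime p} (f : {poly padic_int p_pr})
    (k : nat) (y z : padic_int p_pr) :
  residue y k = residue z k -> residue f.[y] k = residue f.[z] k.
Proof.
move=> yz; elim/poly_ind: f => [|f a IH]; first by rewrite !horner0.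
rewrite !hornerMXaddC.
have resD (u v : padic_int p_pr) :
  residue (u + v) k = ((residue u k + residue v k) %% (p ^ k)%:Z)%Z by [].
have resM (u v : padic_int p_pr) :
  residue (u * v) k = ((residue u k * residue v k) %% (p ^ k)%:Z)%Z by [].
by rewrite !resD !resM IH yz.
Qed.

Lemma residue_range {p : nat} {p_pr : prime p} (y : padic_int p_pr) k :
  0 <= residue y k < (p ^ k)%:Z.
Proof.
rewrite -residue_mod modz_ge0 ?ltz_pmod ?ltz_nat //=.
by rewrite expn_gt0 prime_gt0.
by rewrite gt_eqF // ltz_nat expn_gt0 prime_gt0.
Qed.

Lemma residue_orbit_eventually_periodic {p : nat} {p_pr : prime p}
    (f : {poly padic_int p_pr}) (x : padic_int p_pr) (k : nat) :
  eventually_periodic (fun n => residue (iter n (fun y => f.[y]) x) k).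
Proof.
have rngP (y : padic_int p_pr) := residue_range y k.
have := @eventually_periodic_iter _ (p ^ k) (fun y => `|residue y k|%N)
  (fun y => f.[y]) x.
case=> [y|y z yz|m [M [M_gt0 gP]]].
- by have /andP[y0 ylt] := rngP y; rewrite -ltz_nat gez0_abs.
- have {}yz : residue y k = residue z k.
    have /andP[y0 _] := rngP y; have /andP[z0 _] := rngP z.
    by rewrite -(gez0_abs y0) -(gez0_abs z0) yz.
  by rewrite (horner_residue f k y z).
exists m, M; split=> // n mn.
set u := iter _ _ _; set v := iter _ _ _.
have /andP[u0 _] := rngP u; have /andP[v0 _] := rngP v.
by rewrite -(gez0_abs u0) -(gez0_abs v0) gP.
Qed.

(** * Natural-valued rational polynomials *)

Lemma dvdz_horner_sub (P : {poly int}) (a b : int) : (a - b %| P.[a] - P.[b])%Z.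
Proof.
elim/poly_ind: P => [|P u IH]; first by rewrite !horner0 subrr dvdz0.
rewrite !hornerMXaddC.
have -> : P.[a] * a + u - (P.[b] * b + u) =
  (P.[a] - P.[b]) * a + P.[b] * (a - b) by ring.
by apply: rpredD; [exact: dvdz_mulr | exact: dvdz_mull].
Qed.

(** Factor out the natural roots one at a time; the degree drops each time. *)
Lemma horner_nat_neq0 (P : {poly rat}) :
  P != 0 -> exists m, forall n, (m <= n)%N -> P.[n%:R] != 0.
Proof.
elim: {P}(size P).+1 {-2}P (ltnSn (size P)) => // s IH P ltPs P0.
have [nr|] := pselect (forall n, P.[n%:R] != 0); first by exists 0%N.
move=> /existsNP[n /negP/negPn rootPn].
have /factor_theorem[Q PE] : root P n%:R by [].
have Q0 : Q != 0 by apply: contraNneq P0 => Q0; rewrite PE Q0 mul0r.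
have [|m mP] := IH Q _ Q0.
  by move: ltPs; rewrite PE size_Mmonic ?monicXsubC // size_XsubC; lia.
exists (maxn m n.+1) => i; rewrite geq_max => /andP[mi ni].
by rewrite PE hornerM mulf_neq0 ?mP // hornerXsubC subr_eq0 eqr_nat gtn_eqF.
Qed.

Section NatValued.
Context (q : {poly rat}) (q_nat : forall n : nat, q.[n%:R] \is a Num.nat).
Local Notation qn n := (Num.truncn q.[n%:R]).

(** Write [q = P / a] with [P] an integer polynomial.  Since [x - y] divides
    [P x - P y], shifting [n] by [a * r] changes [a * q n] by a multiple of
    [a * r], hence [q n] by a multiple of [r]. *)
Lemma nat_valued_mod r : (0 < r)%N ->
  exists2 M, (0 < M)%N & forall n, qn (n + M)%N = qn n %[mod r].
Proof.
move=> r_gt0; have [P [a a0 qE]] := rat_poly_scale q.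
exists (`|a| * r)%N; first by rewrite muln_gt0 absz_gt0 a0.
move=> n.
have evalP i : a * (qn i)%:Z = P.[i%:Z].
  apply: (@intr_inj rat); rewrite rmorphM /=.
  rewrite -[(qn i)%:~R]/((qn i)%:R : rat) truncnK //.
  rewrite {1}qE hornerZ mulrA divff ?intr_eq0 // mul1r.
  by rewrite -[i%:R]/(i%:Z%:~R) horner_map.
have := dvdz_horner_sub P (n + `|a| * r)%N%:Z n.
rewrite -!evalP -mulrBr PoszD [_ + _ - _]addrC addKr PoszM.
rewrite dvdzE !abszM /= dvdn_pmul2l ?absz_gt0 //.
rewrite -[(r %| _)%N]/(r %| _)%Z -eqz_mod_dvd !modz_nat => /eqP[]//.
Qed.

(** The nonzero polynomial [(q - 0) (q - 1) .. (q - (m - 1))] has finitely many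
    natural roots, and these are the [n] at which [q] takes a value below [m]. *)
Lemma nat_valued_large m : (1 < size q)%N ->
  exists n0, forall n, (n0 <= n)%N -> (m <= qn n)%N.
Proof.
move=> q_nc; pose P : {poly rat} := \prod_(v < m) (q - v%:R%:P).
have /horner_nat_neq0[n0 n0P] : P != 0.
  apply/prodf_neq0 => v _; apply: contraTneq q_nc => /eqP; rewrite subr_eq0.
  by move=> /eqP ->; rewrite size_polyC; case: eqP.
exists n0 => n /n0P; rewrite horner_prod => /prodf_neq0 nP.
rewrite leqNgt; apply/negP => lt_m.
have := nP (Ordinal lt_m) isT.
by rewrite hornerD hornerN hornerC /= truncnK // subrr eqxx.
Qed.

(** A constant [q] may stay inside the preperiod of [g] forever, so it is
    treated apart. *)
Lemma eventually_periodic_nat_valued {A : Type} (g : nat -> A) :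
  eventually_periodic g -> eventually_periodic (fun n => g (qn n)).
Proof.
have [q_c|q_nc] := leqP (size q) 1.
  move=> _; exists 0%N, 1%N; split=> // n _.
  by have /size1_polyC -> := q_c; rewrite !hornerC.
move=> [m [r [r_gt0 gP]]].
have [n0 n0P] := nat_valued_large m q_nc.
have [M M_gt0 qP] := nat_valued_mod r r_gt0.
exists n0, M; split=> // n le_n.
apply: (eventually_periodic_eqmod gP) => //; apply: n0P => //.
exact: leq_trans (leq_addr _ _).
Qed.

End NatValued.

(** * Uniform continuity on a power of Z_p *)

(** An ultrafilter selects one block of any finite partition. *)
Lemma ultra_finite_value (U : set_system nat) (UF : UltraFilter U) (N : nat)
    (h : nat -> nat) : (forall n, (h n < N)%N) ->
  exists v, U [set n | h n = v].
Proof.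
elim: N h => [h /(_ 0%N)//|N IH h hN].
have [|nN] := in_ultra_setVsetC [set n | h n = N] UF; first by exists N.
have [h0|] := pselect (exists n, h n <> N); last first.
  move=> /forallNP H; exists N; apply: filterS nN => n /= hn.
  by have := H n.
have [n0 hn0] := h0.
(* The value N is discarded by the ultrafilter, so it may be redefined. *)
have [n|v vP] := IH (fun n => if h n == N then h n0 else h n).
  case: eqP => hn; first by have := hN n0; move/eqP: hn0; lia.
  by have := hN n; lia.
exists v; apply: filterS2 nN vP => n /= hn.
by case: eqP.
Qed.

(** Compactness of [Z_p] along an ultrafilter: it selects a residue modulo each
    [p^k], and these residues are compatible because two sets of the ultrafilter
    always meet. *)
Lemma ultra_padic_lim {p : nat} {p_pr : prime p} (U : set_system nat)
    (UF : UltraFilter U) (u : nat -> padic_int p_pr) :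
  exists y : padic_int p_pr, forall k, U [set n | residue (u n) k = residue y k].
Proof.
have /choice[r rP] : forall k, exists r, U [set n | residue (u n) k = r].
  move=> k; have [n|v vP] := @ultra_finite_value U UF (p ^ k)
    (fun n => `|residue (u n) k|%N).
    by have /andP[y0 ylt] := residue_range (u n) k; rewrite -ltz_nat gez0_abs.
  exists v%:Z; apply: filterS vP => n /= <-.
  by have /andP[y0 _] := residue_range (u n) k; rewrite gez0_abs.
have rS k : r k = (r k.+1 %% (p ^ k)%:Z)%Z.
  have [n [<- <-]] := filter_ex (filterI (rP k) (rP k.+1)).
  exact: residueP.
by exists (PadicInt p_pr rS).
Qed.

Lemma padic_cvg {p : nat} {p_pr : prime p} (U : set_system nat) (UF : Filter U)
    (u : nat -> padic_int p_pr) (y : padic_int p_pr) :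
  (forall k, U [set n | residue (u n) k = residue y k]) -> u @ U --> y.
Proof.
move=> uy; apply/cvg_entourageP => E [k _ kE].
have : U [set n | E (y, u n)] by apply: filterS (uy k) => n /= un; apply: kE.
by [].
Qed.

(** Stated for a bare index type, which need not carry a topology. *)
Lemma ptws_cvg {I S : Type} {V : topologicalType} (G : set_system S)
    (GF : Filter G) (u : S -> I -> V) (y : I -> V) :
  (forall j, u^~ j @ G --> y j) -> {ptws, u @ G --> y}.
Proof.
move=> uy; rewrite cvg_sup => j.
rewrite cvg_image; last by rewrite eqEsubset; split=> v // _; exists (fun=> v).
move=> W /uy Wu; exists (@^~ j @^-1` W) => //.
by rewrite eqEsubset; split=> [v [? + <-]|v Wv] //; exists (fun=> v).
Qed.

(** If no [k] works, take for each [k] a pair of points that agree modulo [p^k]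
    and whose images are far apart.  Along an ultrafilter finer than the
    neighbourhoods of infinity both components converge to the same point, so
    continuity brings their images together: a contradiction. *)
Lemma uniformly_continuous_mod {R : realType} {p : nat} {p_pr : prime p}
    {l : nat} (F : {ptws 'I_l -> padic_int p_pr} -> R[i]^o) (eps : R[i]) :
  continuous F -> 0 < eps ->
  exists k, forall u v : 'I_l -> padic_int p_pr,
    (forall j, residue (u j) k = residue (v j) k) -> `|F u - F v| <= eps.
Proof.
move=> Fc eps0; apply: contrapT => /forallNP nuc.
pose X := 'I_l -> padic_int p_pr.
have /choice[uv uvP] : forall k, exists uv : X * X,
    (forall j, residue (uv.1 j) k = residue (uv.2 j) k) /\
    ~ (`|F uv.1 - F uv.2| <= eps).
  move=> k; apply: contrapT => /forallNP H; apply: (nuc k) => u v uv.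
  by apply: contrapT => Fuv; apply: (H (u, v)).
have [U [UF U_oo]] :=
  ultraFilterLemma (eventually_filter : ProperFilter (\oo : set_system nat)).
have /choice[y yP] j := ultra_padic_lim U UF (fun n => (uv n).1 j).
have u_y : {ptws, (fun n => (uv n).1) @ U --> y}.
  by apply: ptws_cvg => j; exact: padic_cvg.
have v_y : {ptws, (fun n => (uv n).2) @ U --> y}.
  apply: ptws_cvg => j; apply: padic_cvg => k.
  have Uk : U [set n | (k <= n)%N] by apply: U_oo; exists k.
  apply: filterS2 (yP j k) Uk => n /= <- kn; symmetry.
  by apply: residue_le kn _; have [->] := uvP n.
have Fuv : F (uv n).1 - F (uv n).2 @[n --> U] --> (0 : R[i]^o).
  rewrite -[0](subrr (F y)); apply: cvgB.
    exact: (cvg_comp _ _ u_y (Fc y)).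
  exact: (cvg_comp _ _ v_y (Fc y)).
have /cvgr0Pnorm_le/(_ _ eps0) Fuv_eps := Fuv.
have [n Fn] := filter_ex Fuv_eps.
by have [_] := uvP n; apply.
Qed.

(** * Characters of Z/M *)

Lemma e2piD {R : realType} (s t : R) : e2pi (s + t) = e2pi s * e2pi t.
Proof.
rewrite /e2pi mulrDr cosD sinD; apply/eqP.
by rewrite eq_complex /= eqxx andTb addrC.
Qed.

Lemma e2pi_nat {R : realType} (n : nat) : e2pi (n%:R : R) = 1.
Proof.
elim: n => [|n IH]; first by rewrite /e2pi mulr0 cos0 sin0.
rewrite -addn1 natrD e2piD IH mul1r /e2pi mulr1 mulr_natl cos2pi.
by rewrite sin_mulr2n sinpi mulr0 mul0rn.
Qed.

Lemma e2pi_mulrn {R : realType} (t : R) (n : nat) :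
  e2pi (t * n%:R) = e2pi t ^+ n.
Proof.
elim: n => [|n IH]; first by rewrite mulr0 (e2pi_nat 0).
by rewrite -addn1 natrD mulrDr mulr1 e2piD IH exprD.
Qed.

(** By the double angle formula the real part of [e2pi t] is
    [1 - 2 sin^2 (pi t)], and [sin] is positive on the open interval from [0] to
    [pi]. *)
Lemma e2pi_neq1 {R : realType} (t : R) : 0 < t < 1 -> e2pi t != 1.
Proof.
move=> /andP[t0 t1]; apply/eqP => /(congr1 (@complex.Re _)) /=.
have spos : 0 < sin (pi * t).
  by apply: sin_gt0_pi; rewrite mulr_gt0 ?pi_gt0 //= gtr_pMr ?pi_gt0.
have -> : 2 * pi * t = (pi * t) *+ 2 by rewrite -mulrA mulr_natl.
rewrite cos_mulr2n cos2sin2.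
have := exprn_gt0 2 spos; move: (sin _ ^+ 2) => s; lra.
Qed.

(** Orthogonality of characters: for [0 < m] this is a geometric sum whose ratio
    is an [M]-th root of unity other than [1]. *)
Lemma sum_e2pi_root {R : realType} (M m : nat) : (m < M)%N ->
  \sum_(a < M) e2pi (m%:R / M%:R : R) ^+ a = if m == 0%N then M%:R else 0.
Proof.
move=> mM; have M0 : M%:R != 0 :> R by rewrite pnatr_eq0; lia.
case: eqP => [->|/eqP m0].
  rewrite mul0r (e2pi_nat 0) (eq_bigr (fun=> 1)) => [|a _]; last exact: expr1n.
  by rewrite sumr_const card_ord.
set w := e2pi _.
have w1 : w - 1 != 0.
  rewrite subr_eq0; apply: e2pi_neq1.
  rewrite divr_gt0 ?ltr0n ?lt0n //=; last lia.
  by rewrite ltr_pdivrMr ?mul1r ?ltr_nat ?ltr0n; lia.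
apply: (mulfI w1); rewrite -subrX1 -e2pi_mulrn divfK // e2pi_nat.
by rewrite subrr mulr0.
Qed.

(** Finite Fourier inversion: the inner sum over [a] is [g b] times the indicator
    of [n = b] modulo [M].  The conjugate character [exp(- 2 pi i a b / M)] is
    written with [M - b] in place of [- b]. *)
Lemma periodic_expansion {R : realType} (g : nat -> R[i]) (M : nat) :
  (0 < M)%N -> (forall n, g (n + M)%N = g n) ->
  forall n, g n = \sum_(b < M) \sum_(a < M)
   (M%:R^-1 * g b * e2pi ((M - b)%:R / M%:R : R) ^+ a) * e2pi (a%:R / M%:R) ^+ n.
Proof.
move=> M0 gM n; have MR : M%:R != 0 :> R by rewrite pnatr_eq0 -lt0n.
have Mmod b : (b < M)%N -> (((M - b + n) %% M)%N == 0)%N = (b == n %% M)%N.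
  move=> bM; have -> : 0%N = ((M - b + b) %% M)%N by rewrite subnK ?modnn // ltnW.
  by rewrite eqn_modDl (modn_small bM) eq_sym.
have charE b a : e2pi ((M - b)%:R / M%:R : R) ^+ a * e2pi (a%:R / M%:R) ^+ n =
    e2pi (((M - b + n) %% M)%N%:R / M%:R) ^+ a.
  rewrite -!e2pi_mulrn -e2piD.
  rewrite -[RHS]mulr1 -(@e2pi_nat R (((M - b + n) %/ M) * a)%N) -e2piD.
  have := divn_eq (M - b + n) M => /(congr1 (fun k => k%:R : R)).
  rewrite !natrD !natrM => /eqP; rewrite [X in _ == X]addrC -subr_eq => /eqP <-.
  by congr e2pi; field.
transitivity (\sum_(b < M) if (b : nat) == (n %% M)%N then g b else 0).
  rewrite -big_mkcond (big_pred1 (Ordinal (ltn_pmod n M0))) //=.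
  rewrite [in LHS](divn_eq n M) addnC.
  by apply: (periodic_mul (m := 0)) => // k _.
apply: eq_bigr => b _.
under eq_bigr => a _ do rewrite -mulrA charE.
rewrite -big_distrr /= sum_e2pi_root ?ltn_pmod // Mmod //.
case: eqP => _; last by rewrite mulr0.
by rewrite mulrAC mulVf ?mul1r // pnatr_eq0 -lt0n.
Qed.

(** * Averages against an oscillating sequence *)

Lemma cvg_invn0 {R : realType} :
  (fun N => N%:R^-1 : R[i]^o) @ \oo --> (0 : R[i]^o).
Proof.
apply/cvgr0Pnorm_lt => eps eps0.
have [/eqP epsI epsR] : complex.Im eps == 0 /\ 0 < complex.Re eps.
  by move: eps0; case: (eps) => a b; rewrite ltcE /= eq_sym => /andP.
near=> N.
have N0 : 0 < N%:R :> R by near: N; exact: nbhs_infty_gtr.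
rewrite normfV normr_nat (complexE eps) epsI mulr0 addr0.
rewrite -(rmorph_nat (real_complex R)) -fmorphV ltcR.
rewrite invf_plt ?posrE //.
by near: N; exact: nbhs_infty_gtr.
Unshelve. all: by end_near. Qed.

Lemma normcE {R : realType} (z : R[i]) : `|z| = (Normc.normc z)%:C%C.
Proof. by case: z. Qed.

Section WeightedMeans.
Context {R : realType} (c : nat -> R[i]).

Definition weighted_mean (g : nat -> R[i]) (N : nat) : R[i]^o :=
  N%:R^-1 * \sum_(0 <= n < N) c n * g n.

Definition orthogonal_to (g : nat -> R[i]) :=
  weighted_mean g @ \oo --> (0 : R[i]^o).

Lemma orthogonalD g h : orthogonal_to g -> orthogonal_to h ->
  orthogonal_to (fun n => g n + h n).
Proof.
move=> g0 h0; rewrite /orthogonal_to -[0 in X in _ --> X]addr0.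
have -> : weighted_mean (fun n => g n + h n) =
    weighted_mean g \+ weighted_mean h.
  apply/funext => N; rewrite /= /weighted_mean -mulrDr -big_split /=.
  by congr (_ * _); apply: eq_bigr => n _; rewrite mulrDr.
exact: cvgD.
Qed.

Lemma orthogonalZ a g : orthogonal_to g -> orthogonal_to (fun n => a * g n).
Proof.
move=> g0; rewrite /orthogonal_to -(mulr0 a).
have -> : weighted_mean (fun n => a * g n) = (fun N => a * weighted_mean g N).
  apply/funext => N; rewrite /weighted_mean [RHS]mulrCA.
  rewrite [X in _ = _ * X]big_distrr /=.
  by congr (_ * _); apply: eq_bigr => n _; rewrite mulrCA.
exact: cvgMl_tmp.
Qed.

Lemma orthogonal_sum k (g : 'I_k -> nat -> R[i]) :
  (forall i, orthogonal_to (g i)) ->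
  orthogonal_to (fun n => \sum_(i < k) g i n).
Proof.
move=> g0; rewrite -fct_sumE.
elim/big_ind: _ => [|u v u0 v0|i _]; [|exact: orthogonalD|exact: g0].
rewrite /orthogonal_to (_ : weighted_mean 0 = fun=> 0); first exact: cvg_cst.
apply/funext => N.
by rewrite /weighted_mean big1 ?mulr0 // => n _; rewrite mulr0.
Qed.

Lemma orthogonal_finite_support m g : (forall n, (m <= n)%N -> g n = 0) ->
  orthogonal_to g.
Proof.
move=> g0; set S := \sum_(0 <= n < m) c n * g n.
have := @cvgMr_tmp _ _ _ _ _ _ S cvg_invn0; rewrite mul0r => lim0.
have : \forall N \near \oo, N%:R^-1 * S = weighted_mean g N; last first.
  by move=> eqS P /lim0; exact: near_eq_cvg eqS P.
exists m => // N /= mN.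
rewrite /weighted_mean (big_cat_nat (leq0n m) mN) /= -/S.
rewrite [X in S + X]big_nat_cond [X in S + X]big1 ?addr0 //.
move=> n /andP[/andP[mn _] _].
by rewrite g0 ?mulr0.
Qed.

(** The hypothesis leaves out the term of index [0] and includes the one of index
    [N]; for [1 <= N] the first is absorbed by adding [|c 0|] to the constant,
    and the second is nonnegative. *)
Lemma mean_norm_bounded :
  (fun N : nat => \sum_(1 <= n < N.+1) Normc.normc (c n) : R)
                 =O_\oo (fun N : nat => N%:R : R) ->
  exists2 C : R[i], 0 < C &
    \forall N \near \oo, N%:R^-1 * \sum_(0 <= n < N) `|c n| <= C.
Proof.
move/eqO_exP => [K K0 cK].
pose C := Normc.normc (c 0%N) + K.
have n0 (z : R[i]) : 0 <= Normc.normc z by case: z => a b; exact: sqrtr_ge0.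
have C0 : 0 < C by apply: ltr_wpDl.
have C0' : 0 < C%:C%C by rewrite ltcR.
exists C%:C%C => //.
near=> N.
have N1 : 1 <= N%:R :> R by near: N; exact: nbhs_infty_ger.
have -> : \sum_(0 <= n < N) `|c n| = (\sum_(0 <= n < N) Normc.normc (c n))%:C%C.
  by rewrite rmorph_sum; apply: eq_bigr => n _; exact: normcE.
rewrite -(rmorph_nat (real_complex R)) -fmorphV -rmorphM lecR.
rewrite mulrC ler_pdivrMr; last exact: lt_le_trans N1.
apply: (@le_trans _ _ (\sum_(0 <= n < N.+1) Normc.normc (c n))).
  by rewrite [leRHS]big_nat_recr //= lerDl.
rewrite big_nat_recl // mulrDl lerD //; first by rewrite ler_peMr.
have : `|\sum_(1 <= n < N.+1) Normc.normc (c n)| <= K * `|N%:R| by near: N.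
rewrite big_add1 /=.
by rewrite normr_nat; apply: le_trans; exact: ler_norm.
Unshelve. all: by end_near. Qed.

(** The mean of [c * g] differs from that of [c * h] by at most the supremum of
    [|g - h|] times a bound for the means of [|c|]. *)
Lemma orthogonal_uniform_limit g :
  (fun N : nat => \sum_(1 <= n < N.+1) Normc.normc (c n) : R)
                 =O_\oo (fun N : nat => N%:R : R) ->
  (forall eps, 0 < eps ->
    exists2 h, orthogonal_to h & forall n, `|g n - h n| <= eps) ->
  orthogonal_to g.
Proof.
move=> /mean_norm_bounded[C C0 CP] gP.
apply/cvgr0Pnorm_le => eps eps0.
have [dl dl0 dlC] : exists2 dl, 0 < dl & C * dl = eps / 2.
  by exists (eps / 2 / C); rewrite ?divr_gt0 // mulrC divfK ?gt_eqF.
have [h h0 gh] := gP _ dl0.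
have /cvgr0Pnorm_le/(_ (eps / 2)) h_eps := h0.
near=> N.
have -> : weighted_mean g N =
    weighted_mean h N + N%:R^-1 * \sum_(0 <= n < N) c n * (g n - h n).
  rewrite /weighted_mean -mulrDr -big_split /=; congr (_ * _).
  by apply: eq_bigr => n _; rewrite mulrBr addrC subrK.
rewrite [eps]splitr (le_trans (ler_normD _ _)) // lerD //.
  by near: N; apply: h_eps; rewrite divr_gt0.
rewrite normrM normfV normr_nat.
have CN : N%:R^-1 * \sum_(0 <= n < N) `|c n| <= C by near: N.
rewrite -dlC (le_trans _ (ler_wpM2r (ltW dl0) CN)) // -mulrA.
rewrite ler_wpM2l ?invr_ge0 ?ler0n //.
rewrite (le_trans (ler_norm_sum _ _ _)) // big_distrl /=.
by apply: ler_sum => n _; rewrite normrM ler_wpM2l.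
Unshelve. all: by end_near. Qed.

Lemma orthogonal_char d : oscillating d c -> (1 <= d)%N ->
  forall t : R, orthogonal_to (fun n => e2pi t ^+ n).
Proof.
move=> c_osc d1 t; have := c_osc (t *: 'X).
have -> : (fun N : nat =>
    N%:R^-1 * \sum_(0 <= n < N) c n * e2pi (t *: 'X).[n%:R] : R[i]^o) =
    weighted_mean (fun n => e2pi t ^+ n).
  apply/funext => N; rewrite /weighted_mean; congr (_ * _).
  by apply: eq_bigr => n _; rewrite hornerZ hornerX e2pi_mulrn.
by apply; rewrite (leq_trans (size_scale_leq _ _)) // size_polyX.
Qed.

(** Up to finitely many terms [g] is its translate by a multiple of the period
    larger than the preperiod, which is periodic from the start. *)
Lemma orthogonal_eventually_periodic d g : oscillating d c -> (1 <= d)%N ->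
   eventually_periodic g -> orthogonal_to g.
Proof.
move=> c_osc d1 [m [M [M0 gP]]].
pose h n := g (n + m * M)%N.
have hP n : h (n + M)%N = h n.
  by rewrite /h addnAC gP // (leq_trans _ (leq_addl _ _)) // leq_pmulr.
rewrite (_ : g = fun n => h n + (g n - h n)); last first.
  by apply/funext => n; rewrite addrC subrK.
apply: orthogonalD; last first.
  apply: (orthogonal_finite_support m) => n mn.
  by rewrite /h (periodic_mul _ gP) ?subrr.
rewrite (funext (periodic_expansion h M M0 hP)).
apply: orthogonal_sum => b; apply: orthogonal_sum => a; apply: orthogonalZ.
exact: orthogonal_char c_osc d1 _.
Qed.

End WeightedMeans.

(** * Proof of the theorem *)

Theorem corollary2 (R : realType) (p : nat) (p_pr : prime p)
    (f : {poly padic_int p_pr}) (l : nat) (l_ge1 : (1 <= l)%N)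
    (q : 'I_l -> {poly rat})
    (q_nat : forall (j : 'I_l) (n : nat), (q j).[n%:R] \is a Num.nat)
    (Delta : nat) (DeltaE : Delta = \max_(j < l) (size (q j)).-1)
    (Delta_ge1 : (1 <= Delta)%N)
    (c : nat -> R[i])
    (c_osc : oscillating Delta c)
    (c_bound : (fun N : nat => \sum_(1 <= n < N.+1) Normc.normc (c n) : R)
                 =O_\oo (fun N : nat => N%:R : R))
    (F : {ptws 'I_l -> padic_int p_pr} -> R[i]^o) (F_cont : continuous F)
    (x : padic_int p_pr) :
  let T : padic_int p_pr -> padic_int p_pr := fun y => f.[y] in
  (fun N : nat =>
     N%:R^-1 * \sum_(0 <= n < N)
       c n * F (fun j => iter (Num.truncn (q j).[n%:R]) T x) : R[i]^o)
    @ \oo --> (0 : R[i]^o).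
Proof.
move=> T; pose w n j := iter (Num.truncn (q j).[n%:R]) T x.
apply: (orthogonal_uniform_limit c (fun n => F (w n)) c_bound) => eps eps0.
have [k Fk] := uniformly_continuous_mod F eps F_cont eps0.
have w_per : eventually_periodic (fun n j => residue (w n j) k).
  apply: eventually_periodic_family => j.
  apply: (eventually_periodic_nat_valued (q j) (q_nat j)
    (fun n => residue (iter n T x) k)).
  exact: residue_orbit_eventually_periodic.
have [rho rho_per rhoP] := eventually_periodic_retract w_per.
exists (fun n => F (w (rho n))).
  apply: (orthogonal_eventually_periodic c Delta _ c_osc Delta_ge1).
  exact: (eventually_periodic_comp (fun m => F (w m) : R[i]) rho_per).
move=> n; apply: Fk => j.
by have /(congr1 (fun r => r j)) := rhoP n.
Qed.
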